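(* Let $S$ be a finite set and $r:S\times S\to[0,\infty)$ with $r(x,y)>0$ for all distinct $x,y\in S$. Consider the inclusion process on $S$ with underlying rates $r$ and parameter $d_N>0$ satisfying $\lim_{N\to\infty}d_N\frac{N^2}{(\log N)^2}=0$. Fix $\delta>0$ and let $\mathcal U_N=\{\eta\in\mathcal H_N:\eta_x\le\delta\log N\text{ for some }x\in S\}$, and let $\tau_{\mathcal U_N}$ be the hitting time of $\mathcal U_N$ by the inclusion process. Then there exists a constant $C=C(\delta)>0$ such that for all $N$, $$\sup_{\eta\in\mathcal H_N}\mathbb E_\eta[\tau_{\mathcal U_N}]\le CN.$$
   Context: $\mathcal H_N=\{\eta\in\{0,1,2,\dots\}^S:\sum_{x\in S}\eta_x=N\}$; for $\eta$ with $\eta_x\ge1$, $\sigma^{x,y}\eta$ moves one particle from $x$ to $y$ ($\sigma^{x,y}\eta=\eta$ if $\eta_x=0$). The inclusion process $\eta_N(\cdot)$ is the continuous-time Markov chain on $\mathcal H_N$ with generator $(\mathcal L_NF)(\eta)=\sum_{x\ne y}\eta_x(d_N+\eta_y)r(x,y)\{F(\sigma^{x,y}\eta)-F(\eta)\}$; $\mathbb E_\eta$ is expectation for the process started at $\eta$.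
   Formalization: S is assumed to have at least two elements: if S has one site the chain is frozen at η=N, outside U_N for large N, so the hitting time is infinite; the expected hitting time is written as the jump-chain sum of mean holding times before hitting U_N. *)

(* Defs.v *)
From HB Require Import structures.
From mathcomp Require Import all_boot all_order all_algebra.
From mathcomp Require Import all_classical all_reals all_analysis.
Set Implicit Arguments. Unset Strict Implicit. Unset Printing Implicit Defensive.
Import Order.TTheory GRing.Theory Num.Theory.
Local Open Scope ring_scope.

(* Configurations of particles on a finite set S: eta : {ffun S -> nat}.
   The configuration space H_N is {eta | \sum_x eta x = N}. *)
Section Inclusion.
Variables (R : realType) (S : finType).

Definition config := {ffun S -> nat}.

Definition sigma_move (x y : S) (eta : config) : config :=
  if eta x == 0%N then eta
  else [ffun z => ((if z == x then (eta z).-1 else eta z) + (z == y))%N].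

Definition incl_rate (d : R) (r : S -> S -> R) (eta : config) (p : S * S) : R :=
  if p.1 != p.2 then (eta p.1)%:R * (d + (eta p.2)%:R) * r p.1 p.2 else 0.

Definition incl_qrate d r (eta : config) : R := \sum_(p : S * S) incl_rate d r eta p.

Definition jump_state (eta : config) (s : seq (S * S)) (k : nat) : config :=
  foldl (fun e p => sigma_move p.1 p.2 e) eta (take k s).

Definition hold_time d r (eta : config) : \bar R :=
  if 0 < incl_qrate d r eta then ((incl_qrate d r eta)^-1)%:E else +oo%E.

(* Expected hitting time E_eta[tau_U] (tau_U = inf{t >= 0 : eta(t) \in U})
   of the continuous-time inclusion process, computed through its standard
   jump-chain / exponential-holding-time construction:
   E_eta[tau_U] = sum_{n>=0} E[ holding time of the n-th visited state ;
                                the first n+1 visited states avoid U ]. *)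
Definition hit_term d r (U : pred config) (eta : config) (n : nat) : \bar R :=
  (\sum_(s : n.-tuple (S * S))
     (if all (fun k => ~~ U (jump_state eta s k)) (iota 0 n.+1) then
        (\prod_(k < n) (incl_rate d r (jump_state eta s k) (tnth s k)
                        / incl_qrate d r (jump_state eta s k)))%:E
        * hold_time d r (jump_state eta s n)
      else 0))%E.

Definition exp_hitting_time d r (U : pred config) (eta : config) : \bar R :=
  (\sum_(0 <= n <oo) hit_term d r U eta n)%E.

Definition U_set (delta : R) (N : nat) : pred config :=
  fun eta => [exists x, (eta x)%:R <= delta * ln (N%:R : R)].

End Inclusion.

(* Main.v *)
Require Import Defs.
From HB Require Import structures.
From mathcomp Require Import all_boot all_order all_algebra.
From mathcomp Require Import all_classical all_reals all_analysis.
From mathcomp Require Import ring lra.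
Set Implicit Arguments.
Unset Strict Implicit.
Unset Printing Implicit Defensive.
Import Order.TTheory GRing.Theory Num.Theory.
Import numFieldNormedType.Exports.
Local Open Scope classical_set_scope.
Local Open Scope ring_scope.

(** A nonnegative [F] whose drift is at most [-1] outside [U] bounds the
    expected hitting time of [U].  Take [F] proportional to
    [sum_x p_x H(eta_x)] with [H] the harmonic numbers and [p] an optimal
    strategy of the symmetric zero-sum game with payoffs [r y x - r x y]: the
    choice of [p] makes the first-order part of the drift nonpositive, and what
    remains is of order [- eta_y / eta_x <= - delta ln N / N] once [d_N <= 1/2].
    As [H(eta_x) <= 1 + ln N], this gives [E[tau] = O(N)].  The finitely many
    remaining [N] are handled one at a time, with a steeply concave function of
    a single occupation number. *)

Lemma big_tuple_cons (V : nmodType) (T : finType) (n : nat)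
    (F : n.+1.-tuple T -> V) :
  \sum_(s : n.+1.-tuple T) F s = \sum_p \sum_(t : n.-tuple T) F [tuple of p :: t].
Proof.
rewrite pair_bigA /=.
rewrite (reindex (fun z : T * n.-tuple T => [tuple of z.1 :: z.2])) //=.
exists (fun s : n.+1.-tuple T => (thead s, [tuple of behead s])).
- by case=> p t _ /=; rewrite theadE; congr pair; exact: val_inj.
- by move=> s _; rewrite [RHS]tuple_eta.
Qed.

Lemma incl_rate_ge0 (R : realType) (S : finType) (d : R) (r : S -> S -> R)
    (eta : config S) (p : S * S) :
  0 <= d -> (forall x y, 0 <= r x y) -> 0 <= incl_rate d r eta p.
Proof.
move=> d0 r0; rewrite /incl_rate; case: ifP => // _.
by rewrite !mulr_ge0 ?addr_ge0.
Qed.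

Lemma hold_time_ge0 (R : realType) (S : finType) (d : R) (r : S -> S -> R)
    (eta : config S) : (0 <= hold_time d r eta)%E.
Proof. by rewrite /hold_time; case: ifP => // q0; rewrite lee_fin invr_ge0 ltW. Qed.

Lemma hit_term_ge0 (R : realType) (S : finType) (d : R) (r : S -> S -> R)
    (U : pred (config S)) (eta : config S) (n : nat) :
  0 <= d -> (forall x y, 0 <= r x y) -> (0 <= hit_term d r U eta n)%E.
Proof.
move=> d0 r0; apply: sume_ge0 => s _; case: ifP => // _.
apply: mule_ge0; last exact: hold_time_ge0.
rewrite lee_fin; apply: prodr_ge0 => k _.
rewrite divr_ge0 ?incl_rate_ge0 //.
by apply: sumr_ge0 => p _; exact: incl_rate_ge0.
Qed.

Lemma hit_term0 (R : realType) (S : finType) (d : R) (r : S -> S -> R)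
    (U : pred (config S)) (eta : config S) :
  hit_term d r U eta 0 = if U eta then 0%E else hold_time d r eta.
Proof.
rewrite /hit_term (big_pred1 [tuple]) /=; last first.
  by move=> t; apply/esym/eqP; exact: tuple0.
rewrite /jump_state /= andbT big_ord0 mul1e.
by case: (U eta).
Qed.

Lemma hit_termS (R : realType) (S : finType) (d : R) (r : S -> S -> R)
    (U : pred (config S)) (eta : config S) (n : nat) :
  0 <= d -> (forall x y, 0 <= r x y) ->
  hit_term d r U eta n.+1 =
  if U eta then 0%E else
  (\sum_(p : S * S) (incl_rate d r eta p / incl_qrate d r eta)%:E
    * hit_term d r U (sigma_move p.1 p.2 eta) n)%E.
Proof.
move=> d0 r0; rewrite {1}/hit_term big_tuple_cons.
have allE (p : S * S) (t : n.-tuple (S * S)) :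
    all (fun k => ~~ U (jump_state eta (p :: t) k)) (iota 0 n.+2) =
    ~~ U eta && all (fun k => ~~ U (jump_state (sigma_move p.1 p.2 eta) t k))
                    (iota 0 n.+1).
  have -> : iota 0 n.+2 = 0%N :: map (addn 1) (iota 0 n.+1) by rewrite -iotaDl.
  by move: (iota 0 n.+1) => l; rewrite /= all_map.
case: ifP => Ueta.
  by rewrite big1 // => p _; rewrite big1 // => t _; rewrite allE Ueta.
apply: eq_bigr => p _; rewrite /hit_term ge0_sume_distrr; last first.
  move=> t _; case: ifP => // _; apply: mule_ge0; last exact: hold_time_ge0.
  rewrite lee_fin; apply: prodr_ge0 => k _.
  rewrite divr_ge0 ?incl_rate_ge0 //.
  by apply: sumr_ge0 => q _; exact: incl_rate_ge0.
apply: eq_bigr => t _; rewrite allE Ueta /=.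
case: ifP => _; last by rewrite mule0.
rewrite big_ord_recl /= EFinM -muleA; congr (_ * (_ * _))%E.
by congr EFin; apply: eq_bigr => k _; rewrite tnthS.
Qed.

Lemma sum_sigma_move (S : finType) (x y : S) (eta : config S) :
  (\sum_z sigma_move x y eta z = \sum_z eta z)%N.
Proof.
rewrite /sigma_move; case: eqP => // /eqP; rewrite -lt0n => ex.
under eq_bigr do rewrite ffunE.
rewrite big_split /= (bigD1 x) //= eqxx [in RHS](bigD1 x) //=.
have -> : (\sum_z (z == y) = 1)%N.
  by rewrite (bigD1 y) //= eqxx big1 // => z /negbTE ->.
under eq_bigr => z /negbTE -> do [].
by rewrite addnAC addn1 prednK.
Qed.

(* Partial sums of the series are bounded by [F] through first-step analysis:
   waiting at [eta] costs [1 / q(eta)], which the drift of [F] compensates. *)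
Lemma exp_hitting_time_le (R : realType) (S : finType) (d : R) (r : S -> S -> R)
    (U : pred (config S)) (N : nat) (F : config S -> R) :
  0 <= d -> (forall x y, 0 <= r x y) ->
  (forall eta : config S, (\sum_x eta x)%N = N -> 0 <= F eta) ->
  (forall eta : config S, (\sum_x eta x)%N = N -> ~~ U eta ->
    \sum_p incl_rate d r eta p * (F (sigma_move p.1 p.2 eta) - F eta) <= -1) ->
  forall eta : config S, (\sum_x eta x)%N = N ->
    (exp_hitting_time d r U eta <= (F eta)%:E)%E.
Proof.
move=> d0 r0 F0 LF eta etaN; rewrite /exp_hitting_time.
apply: lime_le.
  by apply: is_cvg_nneseries => n _ _; exact: hit_term_ge0.
apply: nearW => n.
elim: n eta etaN => [|n IH] eta etaN.
  by rewrite big_geq // lee_fin F0.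
rewrite big_nat_recl //= hit_term0.
under eq_bigr do rewrite hit_termS //.
case: ifPn => Ueta; first by rewrite big1 // adde0 lee_fin F0.
have rate0 p : 0 <= incl_rate d r eta p by exact: incl_rate_ge0.
have q0 : 0 < incl_qrate d r eta.
  rewrite lt_neqAle sumr_ge0 ?andbT //; apply/eqP => /esym q0.
  have := LF _ etaN Ueta; rewrite big1 ?ler0N1 // => p _.
  by rewrite (psumr_eq0P _ q0) ?mul0r.
rewrite /hold_time q0 exchange_big /=.
have step : (\sum_(p : S * S) \sum_(0 <= i < n)
     ((incl_rate d r eta p / incl_qrate d r eta)%:E
       * hit_term d r U (sigma_move p.1 p.2 eta) i)
   <= (\sum_(p : S * S) incl_rate d r eta p / incl_qrate d r eta
        * F (sigma_move p.1 p.2 eta))%:E)%E.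
  rewrite -sumEFin; apply: lee_sum => p _.
  rewrite -ge0_sume_distrr; last by move=> i _; exact: hit_term_ge0.
  rewrite [leRHS]EFinM; apply: lee_wpmul2l.
    by rewrite lee_fin divr_ge0 // ltW.
  by apply: IH; rewrite sum_sigma_move.
apply: le_trans (leeD (lexx _) step) _.
rewrite -EFinD lee_fin.
under eq_bigr do rewrite mulrAC.
rewrite -mulr_suml -[X in X + _]mul1r -mulrDl ler_pdivrMr // mulrC.
have := LF _ etaN Ueta.
under eq_bigr do rewrite mulrBr.
rewrite sumrB -mulr_suml -/(incl_qrate d r eta); lra.
Qed.

Lemma continuous_sumr (R : realType) (T : topologicalType) (I : Type)
    (s : seq I) (f : I -> T -> R) :
  (forall i, continuous (f i)) -> continuous (fun v => \sum_(i <- s) f i v).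
Proof.
move=> cf; elim: s => [|i s IH] v.
  under eq_fun do rewrite big_nil; exact: cvg_cst.
under eq_fun do rewrite big_cons.
by apply: (@continuousD _ _ _ (f i)); [exact: cf|exact: IH].
Qed.

Lemma compact_simplex (R : realType) (n : nat) :
  compact [set v : 'rV[R]_n | (forall i, 0 <= v ord0 i) /\ \sum_i v ord0 i = 1].
Proof.
have cb : compact [set v : 'rV[R]_n | forall i, `[0%R, 1%R]%classic (v ord0 i)].
  exact: (@rV_compact R n (fun=> `[0%R, 1%R]%classic)
    (fun=> @segment_compact R 0 1)).
have cs : closed ((fun v : 'rV[R]_n => \sum_i v ord0 i) @^-1` [set x : R | x = 1]).
  apply: preimage_closed; last exact: closed_eq.
  by move=> v _; apply: continuous_sumr => i; exact: coord_continuous.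
have := compact_closedI cb cs; congr compact.
apply/seteqP; split=> v /= [v0 v1]; split=> // i.
  by have := v0 i; rewrite in_itv /= => /andP[].
rewrite in_itv /= v0 /= -v1 (bigD1 i) //= lerDl.
by apply: sumr_ge0 => j _.
Qed.

(* The optimal strategy of a symmetric zero-sum game.  Let [p] minimise
   [phi p = sum_j ((p A)_j ^+)^2] over the simplex and let [w] be the positive
   part of [p A].  Since [w A w^T = 0], moving [p] towards [w] changes the
   unnormalised value of [phi] only at second order, whereas normalisation
   lowers it at first order unless [w = 0]. *)
Lemma skew_optimal_strategy_ord (R : realType) (n : nat)
    (A : 'I_n.+1 -> 'I_n.+1 -> R) :
  (forall i j, A j i = - A i j) ->
  exists p : 'I_n.+1 -> R, [/\ forall i, 0 <= p i, \sum_i p i = 1 &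
    forall j, \sum_i p i * A i j <= 0].
Proof.
move=> Askew.
pose a (v : 'rV[R]_n.+1) j := \sum_i v ord0 i * A i j.
pose phi v := \sum_j Num.max 0 (a v j) * Num.max 0 (a v j).
pose K := [set v : 'rV[R]_n.+1 | (forall i, 0 <= v ord0 i) /\ \sum_i v ord0 i = 1].
have K0 : K !=set0.
  exists (\row_j (j == ord0)%:R); split=> [i|]; first by rewrite mxE.
  rewrite (bigD1 ord0) //= mxE eqxx big1 ?addr0 // => i /negbTE i0.
  by rewrite mxE i0.
have ca j : continuous (fun v => a v j).
  apply: continuous_sumr => i v.
  apply: (@continuousM _ _ (fun v : 'rV[R]_n.+1 => v ord0 i) (fun=> A i j)).
    exact: coord_continuous.
  exact: cst_continuous.
have cm j : continuous (fun v => Num.max 0 (a v j)).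
  move=> v; apply: (@continuous_max _ _ (fun=> 0) (fun v => a v j)).
    exact: cst_continuous.
  exact: ca.
have cphi : continuous phi.
  apply: continuous_sumr => j v.
  by apply: (@continuousM _ _ (fun v => Num.max 0 (a v j))
    (fun v => Num.max 0 (a v j))); exact: cm.
have [p] := EVT_min_rV K0 (@compact_simplex R n.+1) (continuous_subspaceT cphi).
rewrite inE => -[p0 p1] pmin.
exists (p ord0); split=> // j0; rewrite -/(a p j0).
pose w j := Num.max 0 (a p j); pose s := \sum_j w j.
pose b j := \sum_i w i * A i j; pose Q := \sum_j b j * b j.
have w0 j : 0 <= w j by rewrite le_max lexx.
have s0 : 0 <= s by exact: sumr_ge0.
have Q0 : 0 <= Q by apply: sumr_ge0 => j _; rewrite -expr2 sqr_ge0.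
have phi0 : 0 <= phi p by apply: sumr_ge0 => j _; apply: mulr_ge0; exact: w0.
have wb : \sum_j w j * b j = 0.
  have E : \sum_j w j * b j = - \sum_j w j * b j.
    rewrite -[RHS]sumrN.
    under eq_bigr do rewrite mulr_sumr.
    rewrite exchange_big /=; apply: eq_bigr => i _.
    rewrite -mulrN -sumrN mulr_sumr; apply: eq_bigr => j _.
    by rewrite (Askew j i); ring.
  lra.
have perturb e : 0 < e -> phi p * (1 + e * s) ^+ 2 <= phi p + e ^+ 2 * Q.
  move=> e0; have es : 0 < 1 + e * s by rewrite ltr_pwDl // mulr_ge0 // ltW.
  pose v : 'rV[R]_n.+1 := \row_i ((p ord0 i + e * w i) / (1 + e * s)).
  have av j : a v j = (a p j + e * b j) / (1 + e * s).
    rewrite /a /b mulr_sumr -big_split /= mulr_suml; apply: eq_bigr => i _.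
    by rewrite mxE; ring.
  have vK : v \in K.
    rewrite inE; split=> [i|].
      by rewrite mxE divr_ge0 ?addr_ge0 ?mulr_ge0 // ltW.
    under eq_bigr do rewrite mxE.
    by rewrite -mulr_suml big_split /= -mulr_sumr p1 divff // gt_eqF.
  rewrite -ler_pdivlMr ?exprn_gt0 //; apply: le_trans (pmin _ vK) _.
  have -> : phi p + e ^+ 2 * Q = \sum_j (w j + e * b j) ^+ 2.
    have -> : phi p + e ^+ 2 * Q = phi p + 2 * e * (\sum_j w j * b j) + e ^+ 2 * Q.
      by rewrite wb mulr0 addr0.
    rewrite /phi /Q !mulr_sumr -!big_split /=; apply: eq_bigr => j _.
    by rewrite -/(w j); ring.
  rewrite mulr_suml; apply: ler_sum => j _.
  have le_w : a p j <= w j by rewrite le_max lexx orbT.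
  rewrite av.
  case: (leP 0 ((a p j + e * b j) / (1 + e * s))) => [ge0|_]; last first.
    by rewrite mul0r divr_ge0 ?sqr_ge0.
  have -> : (a p j + e * b j) / (1 + e * s) * ((a p j + e * b j) / (1 + e * s)) =
            (a p j + e * b j) ^+ 2 / (1 + e * s) ^+ 2.
    by field; rewrite gt_eqF.
  rewrite ler_pM2r ?invr_gt0 ?exprn_gt0 //.
  have {}ge0 : 0 <= a p j + e * b j by rewrite pmulr_lge0 ?invr_gt0 in ge0.
  by rewrite lerXn2r ?nnegrE //; lra.
rewrite leNgt; apply/negP => aj.
have wj : 0 < w j0 by rewrite lt_max aj orbT.
have sgt : 0 < s.
  rewrite /s (bigD1 j0) //= ltr_pwDl //; exact: sumr_ge0.
have phigt : 0 < phi p.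
  rewrite /phi (bigD1 j0) //= ltr_pwDl // ?mulr_gt0 //.
  by apply: sumr_ge0 => j _; apply: mulr_ge0; exact: w0.
have Qp : 0 < Q + 1 by lra.
pose t := s * phi p; have t0 : 0 < t by exact: mulr_gt0.
have e0 : 0 < t / (Q + 1) by exact: divr_gt0.
have := perturb _ e0; move: e0; set e := t / (Q + 1) => e0.
have eQ : t = e * (Q + 1) by rewrite /e divfK ?gt_eqF.
have -> : phi p * (1 + e * s) ^+ 2 = phi p + e * (2 * t) + e ^+ 2 * (t * s).
  by rewrite /t; ring.
have ets : 0 <= e ^+ 2 * (t * s) by rewrite mulr_ge0 ?sqr_ge0 // mulr_ge0 // ltW.
have -> : e * (2 * t) = 2 * (e ^+ 2 * Q) + 2 * e ^+ 2 by rewrite eQ; ring.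
have e2 : 0 < e ^+ 2 by exact: exprn_gt0.
have e2Q : 0 <= e ^+ 2 * Q by rewrite mulr_ge0 // ltW.
lra.
Qed.

Lemma skew_optimal_strategy (R : realType) (S : finType) (A : S -> S -> R) :
  (0 < #|S|)%N -> (forall x y, A y x = - A x y) ->
  exists p : S -> R, [/\ forall x, 0 <= p x, \sum_x p x = 1 &
    forall y, \sum_x p x * A x y <= 0].
Proof.
move=> S0 Askew.
case ES : #|S| S0 => [//|n] _.
pose c := cast_ord (esym ES) : 'I_n.+1 -> 'I_#|S|.
have [p [p0 p1 pA]] := @skew_optimal_strategy_ord R n
  (fun i j => A (enum_val (c i)) (enum_val (c j))) (fun i j => Askew _ _).
pose u x : 'I_n.+1 := cast_ord ES (enum_rank x).
have cu x : enum_val (c (u x)) = x by rewrite /c /u cast_ordK enum_rankK.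
have uc i : u (enum_val (c i)) = i by rewrite /c /u enum_valK cast_ordKV.
have sumE (f : S -> R) : \sum_x f x = \sum_i f (enum_val (c i)).
  by rewrite (reindex (enum_val \o c)) //=; exists u => z _ /=.
exists (p \o u); split=> [x|| y] /=.
- exact: p0.
- by rewrite sumE; under eq_bigr do rewrite uc.
- rewrite sumE; under eq_bigr do rewrite uc.
  by have := pA (u y); rewrite cu.
Qed.

Lemma sigma_move_src (S : finType) (x y : S) (eta : config S) :
  x != y -> sigma_move x y eta x = (eta x).-1.
Proof.
move=> /negbTE xy; rewrite /sigma_move; case: eqP => [->//|_].
by rewrite ffunE eqxx xy addn0.
Qed.

Lemma sigma_move_tgt (S : finType) (x y : S) (eta : config S) :
  x != y -> (0 < eta x)%N -> sigma_move x y eta y = (eta y).+1.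
Proof.
move=> xy; rewrite lt0n => /negbTE ex; rewrite /sigma_move ex ffunE eqxx.
by rewrite eq_sym (negbTE xy) addn1.
Qed.

Lemma sigma_move_other (S : finType) (x y z : S) (eta : config S) :
  z != x -> z != y -> sigma_move x y eta z = eta z.
Proof.
move=> /negbTE zx /negbTE zy; rewrite /sigma_move; case: eqP => // _.
by rewrite ffunE zx zy addn0.
Qed.

Lemma generator_site (R : realType) (S : finType) (d : R) (r : S -> S -> R)
    (eta : config S) (x : S) (g : nat -> R) :
  \sum_p incl_rate d r eta p * (g (sigma_move p.1 p.2 eta x) - g (eta x)) =
  \sum_(y | y != x)
    ((eta y)%:R * (d + (eta x)%:R) * r y x * (g (eta x).+1 - g (eta x)) +
     (eta x)%:R * (d + (eta y)%:R) * r x y * (g (eta x).-1 - g (eta x))).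
Proof.
rewrite (eq_bigr (fun p => incl_rate d r eta (p.1, p.2) *
  (g (sigma_move p.1 p.2 eta x) - g (eta x)))); last by case.
rewrite -(pair_bigA _ (fun a b => incl_rate d r eta (a, b) *
  (g (sigma_move a b eta x) - g (eta x)))) /=.
rewrite (bigD1 x) //= (bigD1 x) //= {1}/incl_rate /= eqxx mul0r add0r addrC.
rewrite -big_split /=; apply: eq_bigr => y yx; congr (_ + _); last first.
  by rewrite sigma_move_src 1?eq_sym // /incl_rate /= eq_sym yx.
rewrite (bigD1 x) //= big1 ?addr0; last first.
  by move=> z zx; rewrite sigma_move_other 1?eq_sym // subrr mulr0.
rewrite /incl_rate /= yx; have [->|ey] := posnP (eta y); first by rewrite !mul0r.
by rewrite sigma_move_tgt.
Qed.

Lemma notin_U_set (R : realType) (S : finType) (delta : R) (N : nat)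
    (eta : config S) (x : S) :
  ~~ @U_set R S delta N eta -> delta * ln (N%:R : R) < (eta x)%:R.
Proof. by rewrite negb_exists => /forallP /(_ x); rewrite -ltNge. Qed.

Lemma notin_U_set_gt0 (R : realType) (S : finType) (delta : R) (N : nat)
    (eta : config S) (x : S) :
  0 <= delta -> ~~ @U_set R S delta N eta -> (0 < eta x)%N.
Proof.
move=> delta0 /(@notin_U_set _ _ _ _ _ x); rewrite -(@ltr0n R).
apply: le_lt_trans; apply: mulr_ge0 => //.
case: N => [|N]; first by rewrite ln0.
by rewrite ln_ge0 // ler1n.
Qed.

Lemma leq_config_sum (S : finType) (eta : config S) (x y : S) :
  y != x -> (eta x + eta y <= \sum_z eta z)%N.
Proof.
move=> yx; rewrite (bigD1 x) //= (bigD1 y) //= addnA; exact: leq_addr.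
Qed.

Lemma exists_neq (S : finType) (x : S) : (2 <= #|S|)%N -> exists y, y != x.
Proof.
move=> S2; have : (0 < #|predC1 x|)%N by rewrite cardC1; case: #|S| S2 => [|[]].
by case/card_gt0P => y; rewrite inE; exists y.
Qed.

(* The increments [B ^+ (N - k)] of [g] decrease so fast that at every level
   the downward jumps outweigh the upward ones. *)
Lemma exp_hitting_time_fixed_size (R : realType) (S : finType) (r : S -> S -> R)
    (d delta : R) (N : nat) :
  (2 <= #|S|)%N -> (forall x y, 0 <= r x y) ->
  (forall x y, x != y -> 0 < r x y) -> 0 <= d -> 0 <= delta ->
  exists2 C : R, 0 < C & forall eta : config S, (\sum_x eta x)%N = N ->
    (exp_hitting_time d r (@U_set R S delta N) eta <= (C * N%:R)%:E)%E.
Proof.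
move=> S2 r0 rpos d0 delta0.
have [x _] : exists x : S, x \in S by apply/card_gt0P; exact: ltnW.
have [y0 y0x] := exists_neq x S2.
pose K y := N%:R * (d + N%:R) * r y x.
have K0 y : 0 <= K y by rewrite !mulr_ge0 ?addr_ge0.
pose B := 1 + \sum_(y | y != x) (K y + 1) / r x y.
have term0 y : y != x -> 0 <= (K y + 1) / r x y.
  by move=> yx; rewrite divr_ge0 ?addr_ge0.
have B1 : 1 <= B by rewrite lerDl sumr_ge0.
have BK y : y != x -> K y + 1 <= r x y * B.
  move=> yx; have rxy : 0 < r x y by rewrite rpos // eq_sym.
  rewrite mulrC -ler_pdivrMr // /B (bigD1 y) //= addrCA lerDl addr_ge0 //.
  by apply: sumr_ge0 => z /andP[zx _]; exact: term0.
have B0 : 0 < B by apply: lt_le_trans B1.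
pose g k := \sum_(j < k) B ^+ (N - j.+1).
have gS k : g k.+1 = g k + B ^+ (N - k.+1) by rewrite /g big_ord_recr.
exists (B ^+ N) => [|eta etaN]; first exact: exprn_gt0.
apply: (@le_trans _ _ (g (eta x))%:E); last first.
  rewrite lee_fin; apply: (@le_trans _ _ (\sum_(j < eta x) B ^+ N)).
    by apply: ler_sum => j _; rewrite ler_weXn2l // leq_subr.
  rewrite sumr_const card_ord -[_ *+ eta x]mulr_natr ler_pM2l ?exprn_gt0 //.
  by rewrite ler_nat -etaN (bigD1 x) //= leq_addr.
apply: (@exp_hitting_time_le _ _ _ _ _ N (fun e => g (e x))) => //.
  by move=> e _; apply: sumr_ge0 => j _; rewrite exprn_ge0 // ltW.
move=> {etaN}eta etaN etaU; rewrite generator_site.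
have epos z : (0 < eta z)%N by exact: notin_U_set_gt0 etaU.
have le_term y : y != x ->
    (eta y)%:R * (d + (eta x)%:R) * r y x * (g (eta x).+1 - g (eta x)) +
    (eta x)%:R * (d + (eta y)%:R) * r x y * (g (eta x).-1 - g (eta x)) <= -1.
  move=> yx; have := leq_config_sum eta yx; rewrite etaN => exyN.
  have ex := epos x; have ey := epos y.
  have gdown : g (eta x).-1 - g (eta x) = - B ^+ (N - eta x).
    by rewrite -[in X in _ - X](prednK ex) gS prednK // opprD addrA subrr sub0r.
  have gup : g (eta x).+1 - g (eta x) = B ^+ (N - (eta x).+1).
    by rewrite gS addrAC subrr add0r.
  have NE : (N - eta x = (N - (eta x).+1).+1)%N.
    rewrite subnS prednK // subn_gt0 (leq_trans _ exyN) //.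
    by rewrite -[X in (X < _)%N]addn0 ltn_add2l.
  rewrite gdown gup NE exprS.
  set b := B ^+ _; have b1 : 1 <= b by rewrite exprn_ege1.
  have exN : (eta x)%:R <= N%:R :> R.
    by rewrite ler_nat (leq_trans _ exyN) // leq_addr.
  have eyN : (eta y)%:R <= N%:R :> R.
    by rewrite ler_nat (leq_trans _ exyN) // leq_addl.
  have up : (eta y)%:R * (d + (eta x)%:R) * r y x <= K y.
    by rewrite /K ler_wpM2r // ler_pM ?addr_ge0 // lerD2l.
  have down : r x y <= (eta x)%:R * (d + (eta y)%:R) * r x y.
    rewrite ler_peMl // -[leLHS]mulr1 ler_pM // ?ler1n //.
    by apply: (@le_trans _ _ (eta y)%:R); rewrite ?ler1n ?lerDr.
  have h1 := ler_wpM2r (le_trans ler01 b1) up.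
  have h2 := ler_wpM2r (mulr_ge0 (ltW B0) (le_trans ler01 b1)) down.
  have h3 := ler_wpM2r (le_trans ler01 b1) (BK y yx).
  rewrite mulrDl mul1r -[r x y * B * b]mulrA in h3.
  rewrite mulrN; apply: le_trans (lerB h1 h2) _.
  move: h3; move: (K y * b) (r x y * (B * b)) => ? ? ?; lra.
rewrite (bigD1 y0) //= -[leRHS]addr0; apply: lerD; first exact: le_term.
apply: sumr_le0 => y /andP[yx _]; apply: le_trans (le_term y yx) _.
by rewrite lerN10.
Qed.

Definition harmonic_sum (R : realType) (k : nat) : R := \sum_(j < k) j.+1%:R^-1.

Lemma harmonic_sumS (R : realType) (k : nat) :
  harmonic_sum R k.+1 = harmonic_sum R k + k.+1%:R^-1.
Proof. by rewrite /harmonic_sum big_ord_recr. Qed.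

Lemma harmonic_sum_ge0 (R : realType) (k : nat) : 0 <= harmonic_sum R k.
Proof. by apply: sumr_ge0 => j _; rewrite invr_ge0. Qed.

Lemma harmonic_sum_le (R : realType) (k n : nat) :
  (k <= n)%N -> harmonic_sum R k <= harmonic_sum R n.
Proof.
move=> /subnK <-; elim: (n - k)%N => [|i IH] //.
by rewrite addSn harmonic_sumS (le_trans IH) // lerDl invr_ge0.
Qed.

Lemma harmonic_sum_le_ln (R : realType) (n : nat) :
  harmonic_sum R n.+1 <= 1 + ln (n.+1%:R : R).
Proof.
elim: n => [|n IH]; first by rewrite /harmonic_sum big_ord1 ln1 addr0 invr1.
rewrite harmonic_sumS.
have n1 : 0 < n.+1%:R :> R by [].
have n2 : 0 < n.+2%:R :> R by [].
have E : n.+1%:R / n.+2%:R = 1 + - n.+2%:R^-1 :> R.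
  by rewrite -[n.+1%:R](addrK 1) natr1 mulrBl divff ?gt_eqF // mul1r.
have : ln (n.+1%:R / n.+2%:R : R) <= - n.+2%:R^-1.
  by rewrite E le_ln1Dx // ltrN2 invf_lt1 // ltr1n.
rewrite ln_div ?posrE // lerBlDr addrC lerBrDr => h.
by apply: le_trans (lerD IH (lexx _)) _; rewrite -addrA lerD2l.
Qed.

(* A jump into [x], at a rate proportional to [k = eta x], raises the harmonic
   sum by [1 / (k + 1)] rather than [1 / k]; this deficit is the only source of
   negative drift, the first-order term being nonpositive by the choice of [p]. *)
Lemma harmonic_drift (R : realType) (S : finType) (r : S -> S -> R) (d : R)
    (p : S -> R) (eta : config S) (x0 y0 : S) :
  (forall x y, 0 <= r x y) -> 0 <= d -> d <= 2^-1 ->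
  (forall x, 0 <= p x) ->
  (forall y, \sum_x p x * (r y x - r x y) <= 0) ->
  (forall x, 0 < eta x)%N -> y0 != x0 ->
  \sum_q incl_rate d r eta q *
    (\sum_x p x * harmonic_sum R (sigma_move q.1 q.2 eta x) -
     \sum_x p x * harmonic_sum R (eta x))
  <= - (p x0 * ((eta y0)%:R * r y0 x0 / (2 * (eta x0).+1%:R))).
Proof.
move=> r0 d0 d2 p0 pA epos y0x0.
pose T x y := (eta y)%:R * (r y x - r x y) : R.
pose D x y := (eta y)%:R * r y x / (2 * (eta x).+1%:R) : R.
have D0 x y : 0 <= D x y by rewrite divr_ge0 ?mulr_ge0.
have site x : \sum_q incl_rate d r eta q *
    (harmonic_sum R (sigma_move q.1 q.2 eta x) - harmonic_sum R (eta x)) <=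
    \sum_y T x y - \sum_(y | y != x) D x y.
  rewrite generator_site.
  rewrite (bigD1 x (P := predT)) //= {1}/T subrr mulr0 add0r -sumrB.
  apply: ler_sum => y yx.
  have k0 : 0 < (eta x)%:R :> R by rewrite ltr0n.
  have -> : harmonic_sum R (eta x).-1 - harmonic_sum R (eta x) = - (eta x)%:R^-1.
    rewrite -[in X in _ - X](prednK (epos x)) harmonic_sumS prednK //.
    by rewrite opprD addrA subrr sub0r.
  rewrite harmonic_sumS [X in _ * X + _]addrAC subrr add0r /T /D -natr1.
  set k := (eta x)%:R in k0 *; set m := (eta y)%:R.
  have m0 : 0 <= m by [].
  have k1 : 0 < k + 1 by lra.
  have -> : k * (d + m) * r x y * - k^-1 = - ((d + m) * r x y).
    by field; rewrite gt_eqF.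
  have -> : m * (d + k) * r y x / (k + 1) =
            m * r y x - m * r y x * (1 - d) / (k + 1).
    by field; rewrite gt_eqF.
  have -> : m * r y x / (2 * (k + 1)) = m * r y x * 2^-1 / (k + 1).
    by field; rewrite gt_eqF.
  have h1 : m * r y x * 2^-1 / (k + 1) <= m * r y x * (1 - d) / (k + 1).
    rewrite ler_pM2r ?invr_gt0 // ler_wpM2l ?mulr_ge0 //; lra.
  have h2 : 0 <= d * r x y by rewrite mulr_ge0.
  rewrite mulrBr mulrDl; lra.
have -> : \sum_q incl_rate d r eta q *
    (\sum_x p x * harmonic_sum R (sigma_move q.1 q.2 eta x) -
     \sum_x p x * harmonic_sum R (eta x)) =
  \sum_x p x * \sum_q incl_rate d r eta q *
    (harmonic_sum R (sigma_move q.1 q.2 eta x) - harmonic_sum R (eta x)).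
  under [RHS]eq_bigr do rewrite mulr_sumr.
  rewrite exchange_big /=; apply: eq_bigr => q _.
  rewrite -sumrB mulr_sumr; apply: eq_bigr => x _; ring.
apply: le_trans (ler_sum _ (fun x _ => ler_wpM2l (p0 x) (site x))) _.
under eq_bigr do rewrite mulrBr.
rewrite sumrB.
have first_order : \sum_x p x * \sum_y T x y <= 0.
  under eq_bigr do rewrite mulr_sumr.
  rewrite exchange_big /=; apply: sumr_le0 => y _.
  rewrite (eq_bigr (fun x => (eta y)%:R * (p x * (r y x - r x y)))).
    by rewrite -mulr_sumr mulr_ge0_le0.
  by move=> x _; rewrite /T mulrCA.
have second_order : p x0 * D x0 y0 <= \sum_x p x * \sum_(y | y != x) D x y.
  rewrite (bigD1 x0) //= (bigD1 y0) //= mulrDr -addrA lerDl addr_ge0 //.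
    by rewrite mulr_ge0 // sumr_ge0.
  by apply: sumr_ge0 => x _; rewrite mulr_ge0 // sumr_ge0.
rewrite -/(D x0 y0); lra.
Qed.

Lemma exp_hitting_time_small_diffusivity (R : realType) (S : finType)
    (r : S -> S -> R) (delta : R) :
  (2 <= #|S|)%N -> (forall x y, 0 <= r x y) ->
  (forall x y, x != y -> 0 < r x y) -> 0 < delta ->
  exists2 C : R, 0 < C & forall (N : nat) (d : R) (eta : config S),
    1 <= ln (N%:R : R) -> 0 <= d -> d <= 2^-1 -> (\sum_x eta x)%N = N ->
    (exp_hitting_time d r (@U_set R S delta N) eta <= (C * N%:R)%:E)%E.
Proof.
move=> S2 r0 rpos delta0.
have [p [p0 p1 pA]] := @skew_optimal_strategy R S (fun x y => r y x - r x y)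
  (ltnW S2) (fun x y => esym (opprB _ _)).
have [x0 px0] : exists x, 0 < p x.
  apply/existsP; apply: contraPT p1; rewrite negb_exists => /forallP pneg.
  rewrite big1; first by move/eqP; rewrite eq_sym oner_eq0.
  by move=> x _; apply/le_anti; rewrite p0 andbT leNgt pneg.
have [y0 y0x0] := exists_neq x0 S2.
pose c := p x0 * delta * r y0 x0 / 2.
have c0 : 0 < c by rewrite !mulr_gt0 // rpos.
exists (2 / c) => [|N d eta lnN d0 d2 etaN]; first exact: divr_gt0.
case: N => [|n] in lnN etaN *; first by move: lnN; rewrite ln0 // ler10.
set N := n.+1 in lnN etaN *.
have N0 : 0 < N%:R :> R by [].
have l0 : 0 < ln (N%:R : R) by apply: lt_le_trans lnN.
pose a := N%:R / (c * ln (N%:R : R)).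
have a0 : 0 < a by rewrite divr_gt0 // mulr_gt0.
have acl : a * (c * (ln (N%:R : R) / N%:R)) = 1.
  by rewrite /a; field; rewrite !gt_eqF.
apply: (@le_trans _ _ (a * \sum_x p x * harmonic_sum R (eta x))%:E); last first.
  rewrite lee_fin.
  have le_h : \sum_x p x * harmonic_sum R (eta x) <= 1 + ln (N%:R : R).
    apply: le_trans (harmonic_sum_le_ln R n).
    rewrite -[leRHS]mul1r -p1 mulr_suml; apply: ler_sum => x _.
    rewrite ler_wpM2l // harmonic_sum_le // -/N -etaN.
    by rewrite (bigD1 x) //= leq_addr.
  have -> : 2 / c * N%:R = a * (2 * ln (N%:R : R)).
    by rewrite /a; field; rewrite !gt_eqF.
  rewrite ler_pM2l //; lra.
apply: (@exp_hitting_time_le _ _ _ _ _ N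
  (fun e => a * \sum_x p x * harmonic_sum R (e x))) => //.
  move=> e _; apply: mulr_ge0; first exact: ltW.
  by apply: sumr_ge0 => x _; rewrite mulr_ge0 // harmonic_sum_ge0.
move=> {etaN}eta etaN etaU.
under eq_bigr do rewrite -mulrBr mulrCA.
rewrite -mulr_sumr -acl -mulrN ler_pM2l //.
have epos z : (0 < eta z)%N by exact: notin_U_set_gt0 (ltW delta0) etaU.
apply: le_trans (harmonic_drift r0 d0 d2 p0 pA epos y0x0) _.
rewrite lerN2.
have -> : c * (ln (N%:R : R) / N%:R) =
    p x0 * (delta * ln (N%:R : R) * r y0 x0 / (2 * N%:R)).
  by rewrite /c; field; rewrite gt_eqF.
rewrite ler_pM2l // ler_pM //.
- by rewrite !mulr_ge0 // ltW.
- by rewrite ler_wpM2r // ltW // notin_U_set.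
- rewrite lef_pV2 ?posrE ?mulr_gt0 // ler_pM2l // ler_nat -etaN.
  by apply: leq_trans (leq_config_sum eta y0x0); rewrite -addn1 leq_add2l.
Qed.

Theorem theorem3p18 (R : realType) (S : finType) (r : S -> S -> R)
  (d : nat -> R) (delta : R) :
  (2 <= #|S|)%N ->
  (forall x y, 0 <= r x y) ->
  (forall x y, x != y -> 0 < r x y) ->
  (forall N, 0 < d N) ->
  (fun N : nat => d N * (N%:R ^+ 2) / (ln (N%:R : R)) ^+ 2) @ \oo --> (0 : R)%R ->
  0 < delta ->
  exists C : R, 0 < C /\
    forall (N : nat) (eta : config S), (\sum_(x : S) eta x)%N = N ->
      (exp_hitting_time (d N) r (@U_set R S delta N) eta <= (C * N%:R)%:E)%E.
Proof.
move=> S2 r0 rpos d0 dlim delta0.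
have [C1 C10 large] := exp_hitting_time_small_diffusivity S2 r0 rpos delta0.
have fixedN N := exp_hitting_time_fixed_size N S2 r0 rpos (ltW (d0 N)) (ltW delta0).
have /choice[C2 C2P] : forall N, exists C : R, 0 < C /\
    forall eta : config S, (\sum_x eta x)%N = N ->
    (exp_hitting_time (d N) r (@U_set R S delta N) eta <= (C * N%:R)%:E)%E.
  by move=> N; have [C C0 CP] := fixedN N; exists C.
have [N0 _ N0P] : \forall N \near \oo, 1 <= ln (N%:R : R) /\ d N <= 2^-1.
  have half0 : 0 < 2^-1 :> R by [].
  near=> N.
  have Ne : expR 1 <= N%:R :> R by near: N; exact: nbhs_infty_ger.
  have N0 : 0 < N%:R :> R by apply: lt_le_trans (expR_gt0 1) Ne.
  have lnN : 1 <= ln (N%:R : R).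
    by rewrite -[leLHS](expRK 1) ler_ln ?posrE ?expR_gt0.
  split=> //.
  have : `|d N * (N%:R ^+ 2) / (ln (N%:R : R)) ^+ 2| < 2^-1.
    by near: N; exact: (cvgr0_norm_lt _ dlim).
  have l0 : 0 < ln (N%:R : R) by apply: lt_le_trans lnN.
  move=> /ltr_normlW; rewrite ltr_pdivrMr ?exprn_gt0 // => lt_dN.
  have lnle : ln (N%:R : R) ^+ 2 <= N%:R ^+ 2.
    by rewrite lerXn2r ?nnegrE ?(ltW l0) ?(ltW N0) // ltW // ln_sublinear.
  rewrite -(ler_pM2r (exprn_gt0 2 N0)); apply: le_trans (ltW lt_dN) _.
  by rewrite ler_pM2l.
exists (C1 + \sum_(i < N0) C2 i); split.
  by rewrite ltr_pwDl // sumr_ge0 // => i _; rewrite ltW // (C2P i).1.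
move=> N eta etaN; have [N0N|NN0] := leqP N0 N.
  have [lnN dN] := N0P N N0N.
  apply: le_trans (large _ _ _ lnN (ltW (d0 N)) dN etaN) _.
  rewrite lee_fin ler_wpM2r // lerDl sumr_ge0 // => i _.
  by rewrite ltW // (C2P i).1.
apply: le_trans ((C2P N).2 _ etaN) _.
rewrite lee_fin ler_wpM2r // (bigD1 (Ordinal NN0)) //= addrCA lerDl.
rewrite addr_ge0 ?(ltW C10) // sumr_ge0 // => i _.
by rewrite ltW // (C2P i).1.
Unshelve. all: by end_near. Qed.
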